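(* Let $p>1$ be an integer, $\mathbf a=(a_1,\dots,a_p)\in\mathbb Z^p$, $A=\sum_{i=1}^pa_i$, let $\tau,\lambda>0$ with $\lambda+a_i\tau>0$ ($i=1,\dots,p$), and let $$\Delta=\Big\{x\in(\mathbb R^{p+1})^*: x_i\ge0\ (1\le i\le p+1),\ \sum_{i=1}^px_i\le\tau,\ x_{p+1}\le\lambda+\sum_{i=1}^pa_ix_i\Big\}$$ be the corresponding $\Delta_p$ bundle over $\Delta_1$. For $\mathbf b=(b_1,\dots,b_p,b)\in\mathbb Z^{p+1}$, the pair $(\Delta,\mathbf b)$ is mass linear if and only if $\mathcal Z(\mathbf b)=0$, where $$\mathcal Z(\mathbf b)=(p+1)\Big(2\sum_{j=1}^pa_jb_j+b\sum_{j=1}^pa_j^2\Big)-A\Big(2\sum_{j=1}^pb_j+bA\Big).$$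
   Context: Let $\mathfrak t\cong\mathbb R^n$. For fixed outward conormals $\mathbf n_1,\dots,\mathbf n_m\in\mathfrak t$ and $k\in\mathbb R^m$ put $\Delta(k)=\bigcap_{j=1}^m\{x\in\mathfrak t^*:\langle x,\mathbf n_j\rangle\le k_j\}$, with facets $F_j=\Delta(k)\cap\{\langle x,\mathbf n_j\rangle=k_j\}$. For a fixed such polytope $\Delta$ with $m$ facets, its chamber $\mathcal C_\Delta$ is the set of $k'\in\mathbb R^m$ such that for every $J\subset\{1,\dots,m\}$, $\bigcap_{j\in J}F_j\neq\emptyset$ iff $\bigcap_{j\in J}F'_j\ne\emptyset$, where $F'_j$ are the facets of $\Delta(k')$. $\mathrm{Cm}(\cdot)$ denotes the mass center (barycenter for Lebesgue measure). The pair $(\Delta,\mathbf b)$ is mass linear if $k\mapsto\langle\mathrm{Cm}(\Delta(k)),\mathbf b\rangle$ is linear in $k$ on $\mathcal C_\Delta$. Here $n=p+1$, $m=p+3$ and the conormals are $\mathbf n_i=-e_i$ ($1\le i\le p$), $\mathbf n_{p+1}=\sum_{i=1}^pe_i$, $\mathbf n_{p+2}=-e_{p+1}$, $\mathbf n_{p+3}=e_{p+1}-\sum_{i=1}^pa_ie_i$, where $e_1,\dots,e_{p+1}$ is the standard basis of $\mathbb R^{p+1}$. *)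

(* Defs.v *)
(* MathComp and MathComp-Analysis *)
From HB Require Import structures.
From mathcomp Require Import all_boot all_order all_algebra.
From mathcomp Require Import all_classical all_reals all_analysis.

Set Implicit Arguments.
Unset Strict Implicit.
Unset Printing Implicit Defensive.

Import Order.TTheory GRing.Theory Num.Theory numFieldNormedType.Exports.

Local Open Scope classical_set_scope.
Local Open Scope ring_scope.

Section lebesgue_cons.
Context {R : realType} (n : nat).
Let T := measurableTypeR R.

Definition cons_pair (x : T * n.-tuple T) : n.+1.-tuple T :=
  [tuple of x.1 :: x.2].

Lemma measurable_cons_pair : measurable_fun setT cons_pair.
Proof. exact: measurable_cons. Qed.

HB.instance Definition _ :=
  isMeasurableFun.Build _ _ _ _ cons_pair measurable_cons_pair.

Variable mu : {sigma_finite_measure set (n.-tuple T) -> \bar R}.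

Definition lebesgue_cons : set (n.+1.-tuple T) -> \bar R :=
  pushforward (lebesgue_measure \x mu)%E cons_pair.

Let lebesgue_cons0 : lebesgue_cons set0 = 0%E.
Proof. exact: measure0. Qed.

Let lebesgue_cons_ge0 A : (0 <= lebesgue_cons A)%E.
Proof. exact: measure_ge0. Qed.

Let lebesgue_cons_sigma_additive : semi_sigma_additive lebesgue_cons.
Proof.
exact: (@measure_semi_sigma_additive _ _ _
  (pushforward (lebesgue_measure \x mu)%E cons_pair)).
Qed.

HB.instance Definition _ := isMeasure.Build _ _ _ lebesgue_cons
  lebesgue_cons0 lebesgue_cons_ge0 lebesgue_cons_sigma_additive.

Let lebesgue_cons_sigma_finite : sigma_finite setT lebesgue_cons.
Proof.
have /sigma_finiteP[F [TF ndF Foo]] :=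
  sigma_finiteT (lebesgue_measure : {sigma_finite_measure set T -> \bar R}).
have /sigma_finiteP[G [TG ndG Goo]] := sigma_finiteT mu.
pose h (x : n.+1.-tuple T) : T * n.-tuple T := (thead x, [tuple of behead x]).
have mh : measurable_fun setT h.
  apply/measurable_fun_pairP; split; first exact: measurable_tnth.
  exact: measurable_behead.
have consK : h \o cons_pair = id.
  by apply/funext => -[t x]; congr (_, _); apply/val_inj.
exists (fun k => h @^-1` (F k `*` G k)).
  apply/esym/seteqP; split=> // x _.
  have [i _ Fi] : (\bigcup_k F k) (h x).1 by rewrite -TF.
  have [j _ Gj] : (\bigcup_k G k) (h x).2 by rewrite -TG.
  exists (maxn i j) => //; split.
  - by move: Fi; exact/subsetPset/ndF/leq_maxl.
  - by move: Gj; exact/subsetPset/ndG/leq_maxr.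
move=> k; have [mF Fk] := Foo k; have [mG Gk] := Goo k; split.
  by rewrite -[X in measurable X]setTI; apply: mh => //; exact: measurableX.
rewrite /lebesgue_cons /pushforward -comp_preimage consK preimage_id.
by rewrite product_measure1E// lte_mul_pinfty// ge0_fin_numE.
Qed.

HB.instance Definition _ := Measure_isSigmaFinite.Build _ _ _ lebesgue_cons
  lebesgue_cons_sigma_finite.

End lebesgue_cons.

(* Lebesgue measure on R^n, as an iterated product; R^0 has measure 1.
   See lebesgue_tuple_box for the value on boxes. *)
Fixpoint lebesgue_tuple {R : realType} (n : nat) :
    {sigma_finite_measure set (n.-tuple (measurableTypeR R)) -> \bar R} :=
  match n with
  | 0 => \d_([tuple])
  | n'.+1 => lebesgue_cons (lebesgue_tuple n')
  end.

Lemma lebesgue_tuple_box {R : realType} (n : nat)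
    (A : 'I_n -> set (measurableTypeR R)) :
  (forall i, measurable (A i)) ->
  lebesgue_tuple n [set x | forall i, A i (tnth x i)] =
  (\prod_(i < n) lebesgue_measure (A i))%E.
Proof.
elim: n A => [|n IHn] A mA.
  by rewrite big_ord0 /= diracE mem_set//; case.
rewrite big_ord_recl /= /lebesgue_cons /pushforward.
have -> : @cons_pair R n @^-1` [set x | forall i, A i (tnth x i)] =
    A ord0 `*` [set x | forall i, A (lift ord0 i) (tnth x i)].
  apply/seteqP; split=> [[t x] /= Ax|[t x] /= [At Ax] i].
    split; first by have := Ax ord0; rewrite tnth0.
    by move=> i; have := Ax (lift ord0 i); rewrite tnthS.
  case: (unliftP ord0 i) => [j ->|->]; last by rewrite tnth0.
  by rewrite tnthS; exact: Ax.
have mB : measurable [set x : n.-tuple (measurableTypeR R) |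
    forall i, A (lift ord0 i) (tnth x i)].
  rewrite [X in measurable X](_ : _ =
      \bigcap_i ((fun x => tnth x i) @^-1` A (lift ord0 i))); last first.
    by apply/seteqP; split=> x /= Ax i; [move=> _|]; exact: Ax.
  apply: fin_bigcap_measurable => // i _; rewrite -[X in measurable X]setTI.
  exact: measurable_tnth.
by rewrite product_measure1E//; congr (_ * _)%E; exact: IHn.
Qed.

Section polytopes.
Context {R : realType} {n m : nat}.

(* Points of the dual t^* are n-tuples (the carrier of lebesgue_tuple);
   vectors of t, such as the conormals, are row vectors. *)
Let V := n.-tuple (measurableTypeR R).

Definition pairing (x : V) (v : 'rV[R]_n) : R :=
  \sum_(i < n) (tnth x i : R) * v 0 i.

Definition mass_center (P : set V) : V :=
  [tuple Rintegral (lebesgue_tuple n) P (fun x => tnth x i : R) /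
         fine (lebesgue_tuple n P) | i < n].

Variable nu : 'I_m -> 'rV[R]_n.

Definition polytope (k : 'rV[R]_m) : set V :=
  [set x | forall j, pairing x (nu j) <= k 0 j].

Definition facet (k : 'rV[R]_m) (j : 'I_m) : set V :=
  polytope k `&` [set x | pairing x (nu j) = k 0 j].

Definition chamber (k : 'rV[R]_m) : set 'rV[R]_m :=
  [set k' | forall J : set 'I_m,
    \bigcap_(j in J) facet k j !=set0 <-> \bigcap_(j in J) facet k' j !=set0].

(* Mass linearity of the pair (polytope k, b); "linear on the chamber" means
   being there the restriction of a linear form on R^m. *)
Definition mass_linear (k : 'rV[R]_m) (b : 'rV[R]_n) : Prop :=
  exists2 L : 'rV[R]_m -> R, scalar L &
    forall k', chamber k k' -> pairing (mass_center (polytope k')) b = L k'.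

End polytopes.

Section simplex_bundle.
Context {R : realType} {p : nat}.
Implicit Types (a : 'rV[int]_p) (b : 'rV[int]_p.+1) (tau lambda : R).

(* All indices start at 0: bvec i is e_{i+1}, and the conormal of index j
   is n_{j+1}. *)
Definition bvec (i : nat) : 'rV[R]_p.+1 := \row_l (l == i :> nat)%:R.

Definition bundle_conormal a (j : 'I_p.+3) : 'rV[R]_p.+1 :=
  if (j < p)%N then - bvec j
  else if j == p :> nat then \sum_(i < p) bvec i
  else if j == p.+1 :> nat then - bvec p
  else bvec p - \sum_(i < p) (a 0 i)%:~R *: bvec i.

Definition bundle_support tau lambda : 'rV[R]_p.+3 :=
  \row_j (if j == p :> nat then tau
          else if j == p.+2 :> nat then lambda else 0).

(* In R^(p+1), widen_ord (leqnSn p) i for i : 'I_p ranges over the first p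
   coordinates and ord_max is the last one. *)
Lemma bundle_polytopeE a tau lambda :
  polytope (bundle_conormal a) (bundle_support tau lambda) =
  [set x | [/\ forall i, 0 <= (tnth x i : R),
      \sum_(i < p) (tnth x (widen_ord (leqnSn p) i) : R) <= tau &
      (tnth x ord_max : R) <= lambda
        + \sum_(i < p) (a 0 i)%:~R * (tnth x (widen_ord (leqnSn p) i) : R)]].
Proof.
have pairN x v : pairing x (- v) = - pairing x v :> R.
  by rewrite /pairing -sumrN; apply: eq_bigr => i _; rewrite mxE mulrN.
have pairD x v w : pairing x (v + w) = pairing x v + pairing x w :> R.
  by rewrite /pairing -big_split; apply: eq_bigr => i _; rewrite mxE mulrDr.
have pairZ x c v : pairing x (c *: v) = c * pairing x v :> R.
  by rewrite /pairing mulr_sumr; apply: eq_bigr => i _; rewrite mxE mulrCA.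
have pairS x (f : 'I_p -> 'rV[R]_p.+1) :
    pairing x (\sum_i f i) = \sum_i pairing x (f i).
  rewrite /pairing exchange_big; apply: eq_bigr => i _.
  by rewrite summxE mulr_sumr.
have pairB x (i : 'I_p.+1) : pairing x (bvec i) = tnth x i :> R.
  rewrite /pairing (bigD1 i)//= mxE eqxx mulr1 big1 ?addr0// => l li.
  by rewrite mxE (negbTE li : (l == i :> nat) = false) mulr0.
have pairW x (i : 'I_p) : pairing x (bvec i) = tnth x (widen_ord (leqnSn p) i).
  by rewrite -pairB.
have pairL x : pairing x (bvec p) = tnth x ord_max by rewrite -pairB.
have top x : pairing x (\sum_(i < p) (a 0 i)%:~R *: bvec i) =
    \sum_(i < p) (a 0 i)%:~R * (tnth x (widen_ord (leqnSn p) i) : R).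
  by rewrite pairS; apply: eq_bigr => i _; rewrite pairZ pairW.
have ltSp : (p.+1 < p)%N = false by rewrite ltnNge leqnSn.
have ltSSp : (p.+2 < p)%N = false by rewrite ltnNge (leq_trans (leqnSn p)).
have eSSp : (p.+2 == p) = false by rewrite gtn_eqF.
have eSp : (p.+2 == p.+1) = false by rewrite gtn_eqF.
apply/seteqP; split=> x /=.
  move=> Px; split=> [i||].
  - have [ip|pi] := ltnP i p.
      have ip3 : (i < p.+3)%N by rewrite (leq_trans ip)// -addn3 leq_addr.
      have ip2 : (i < p.+2)%N by rewrite (leq_trans ip)// -addn2 leq_addr.
      have := Px (Ordinal ip3).
      rewrite /bundle_conormal mxE /= ip pairN pairB !ltn_eqF//.
      by rewrite oppr_le0.
    have -> : i = ord_max.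
      by apply/val_inj/eqP; rewrite eqn_leq pi -ltnS ltn_ord.
    have := Px (inord p.+1).
    rewrite /bundle_conormal mxE inordK// ltSp gtn_eqF// eqxx ltn_eqF//.
    by rewrite pairN pairL oppr_le0.
  - have := Px (inord p).
    rewrite /bundle_conormal mxE inordK; last by rewrite ltnS ltnW.
    by rewrite ltnn eqxx pairS (eq_bigr _ (fun i _ => pairW x i)).
  - have := Px (inord p.+2).
    rewrite /bundle_conormal mxE inordK// ltSSp eSSp eSp eqxx.
    by rewrite pairD pairN pairL top lerBlDr.
move=> [x0 xtau xlam] j; rewrite /bundle_conormal mxE.
have [jp|pj] := ltnP j p.
  have jp2 : (j < p.+2)%N by rewrite (leq_trans jp)// -addn2 leq_addr.
  by rewrite !ltn_eqF// pairN (pairW _ (Ordinal jp)) oppr_le0.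
have [_|jp] := eqVneq (j : nat) p.
  by rewrite pairS (eq_bigr _ (fun i _ => pairW x i)).
have [->|jp1] := eqVneq (j : nat) p.+1.
  by rewrite ltn_eqF// pairN pairL oppr_le0.
have -> : j == p.+2 :> nat.
  rewrite eqn_leq -ltnS ltn_ord /= ltn_neqAle eq_sym jp1 ltn_neqAle.
  by rewrite eq_sym jp.
by rewrite pairD pairN pairL top lerBlDr.
Qed.

Definition bundle_Z a b : int :=
  let A := \sum_(j < p) a 0 j in
  let b_ (j : 'I_p) := b 0 (widen_ord (leqnSn p) j) in
  let c := b 0 ord_max in
  p.+1%:Z * (2 * \sum_(j < p) a 0 j * b_ j + c * \sum_(j < p) a 0 j ^+ 2)
  - A * (2 * \sum_(j < p) b_ j + c * A).

End simplex_bundle.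

(* Main.v *)
Require Import Defs.
From mathcomp Require Import all_boot all_order all_algebra.
From mathcomp Require Import all_classical all_reals all_analysis.
From mathcomp Require Import measurable_realfun.
From mathcomp Require Import ring lra.
Import Order.TTheory GRing.Theory Num.Theory numFieldNormedType.Exports.
Local Open Scope classical_set_scope.
Local Open Scope ring_scope.

(** The facet data of an arbitrary support vector k enter only through a
translation and three kinds of numbers: after moving the lower corner of the
polytope to the origin it becomes
  [ y_i >= 0, y_1 + ... + y_p <= tau, 0 <= y_(p+1) <= lam + sum_i a_i y_i ],
where the lower corner, tau and lam are linear in k.

The chamber consists of the k for which tau, lam and all lam + a_i tau are
positive: these conditions fix which facets meet, because a family of facets
has a common point exactly when it misses a facet of the simplex factor and
does not contain both the bottom and the roof; conversely, the points where the
families that are maximal for this rule meet force the inequalities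
([nondegenerate_faceE], [face_types_nondegenerate], [bundle_chamberE]).

The volume and first moments are computed together, as the integral of a
nonnegative affine function ([integral_wedge]). Cutting by the first coordinate
gives a polytope of the same kind with p lowered by one, so the integral is an
iterated one. Its outer integral needs no calculation of beta integrals: the
part of the polytope where y_1 >= t is again a member of the same family, so
the closed formula with parameters shifted by t is, up to sign, the
antiderivative of the formula for the slices ([integral_wedge_moment]).

Dividing, the pairing of the mass center with b is
  (linear form in k) + Z(b) * tau^2 / (c * D),   D = lam + A tau / (p+1),
with a positive constant c ([pairing_bundle_center]); D is the mean height of
the polytope over the simplex. If Z(b) = 0 this is linear. Conversely, raising
the roof by 0, 1 and 2 stays in the chamber, moves k along a line and increases
D by 0, 1 and 2; a linear form has zero second difference there, whereas the
second difference of 1 / D is positive, so Z(b) = 0. *)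

Set Implicit Arguments.
Unset Strict Implicit.
Unset Printing Implicit Defensive.

(** * Iterated integration *)

(** The measure on tuples is built by prepending one coordinate at a time, so
Tonelli's theorem integrates the first coordinate last. *)
Lemma lebesgue_tuple_tonelli (R : realType) (n : nat)
    (D : set (n.+1.-tuple (measurableTypeR R)))
    (f : n.+1.-tuple (measurableTypeR R) -> R) :
  measurable D -> measurable_fun setT f -> (forall x, D x -> 0 <= f x) ->
  (\int[lebesgue_tuple n.+1]_(x in D) (f x)%:E =
   \int[lebesgue_measure]_t \int[lebesgue_tuple n]_(x in [set x | D (cons_pair (t, x))])
     (f (cons_pair (t, x)))%:E)%E.
Proof.
move=> mD mf f0.
pose g := (EFin \o f) \_ D.
have mg : measurable_fun setT g.
  apply/(measurable_restrictT _ mD)/measurable_EFinP.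
  exact: measurable_funTS.
have g0 x : (0 <= g x)%E.
  by rewrite /g patchE; case: ifPn => // /set_mem /f0; rewrite lee_fin.
rewrite integral_mkcond -/g.
rewrite (@ge0_integral_pushforward _ _ _ _ _ _ (@measurable_cons_pair R n))//.
rewrite preimage_setT fubini_tonelli1; last 2 first.
  exact: (measurableT_comp mg (@measurable_cons_pair R n)).
  by move=> x; exact: g0.
apply: eq_integral => t _; rewrite /fubini_F [RHS]integral_mkcond.
apply: eq_integral => x _; rewrite /g/= !patchE/=.
by congr (if _ then _ else _); apply/idP/idP; rewrite !inE.
Qed.

Lemma integral_deriv_poly (R : realType) (P : {poly R}) (u v : R) : u <= v ->
  (\int[lebesgue_measure]_(t in `[u, v]) (P^`().[t])%:E = (P.[v] - P.[u])%:E)%E.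
Proof.
rewrite le_eqVlt => /predU1P[->|uv].
  by rewrite set_itv1 integral_set1 subrr.
rewrite (@continuous_FTC2 _ _ (horner P) _ _ uv) ?EFinB//.
- by apply: continuous_subspaceT; exact: continuous_horner.
- split=> [t _||].
  + exact: derivable_horner.
  + by apply: cvg_at_right_filter; exact: continuous_horner.
  + by apply: cvg_at_left_filter; exact: continuous_horner.
- by move=> t _; rewrite derivE.
Qed.


(** * The closed formula for the integral of an affine function *)

(** The integral of d + sum_i c_i y_i + h y_(p+1) over the polytope
[ y_i >= 0, sum_i y_i <= tau, 0 <= y_(p+1) <= lam + sum_i a_i y_i ]. The factor
tau^p / p! is the volume of the simplex; the rest comes from its moments
E y_i = tau / (p+1) and E (y_i y_j) = (1 + [i = j]) tau^2 / ((p+1) (p+2)). The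
term in h comes from half the mean square of the height. *)
Definition wedge_moment (R : realType) (p : nat) (a c : 'I_p -> R)
    (h tau lam d : R) : R :=
  let A := \sum_i a i in
  let C := \sum_i c i in
  tau ^+ p / p`!%:R *
  (d * lam + (d * A + lam * C) * tau / p.+1%:R
   + tau ^+ 2 * (A * C + \sum_i a i * c i) / (p.+1%:R * p.+2%:R)
   + h / 2 * (lam ^+ 2 + 2 * lam * A * tau / p.+1%:R
              + tau ^+ 2 * (A ^+ 2 + \sum_i a i ^+ 2) / (p.+1%:R * p.+2%:R))).

(** The part of the polytope where the first coordinate is at least t is, after
translation, a polytope of the same kind with tau lowered by t, and with lam and
d raised by a_1 t and c_1 t. Hence the formula for it, negated, is an
antiderivative in t of the formula for the slices, and it vanishes at t = tau;
what remains is one identity between polynomials. *)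
Lemma integral_wedge_moment (R : realType) (p : nat) (a c : 'I_p.+1 -> R)
    (h tau lam d u : R) : 0 <= tau ->
  (\int[lebesgue_measure]_(t in `[u, (u + tau)%R])
     (wedge_moment (a \o lift ord0) (c \o lift ord0) h (tau - (t - u))
        (lam + a ord0 * (t - u)) (d + c ord0 * (t - u)))%R%:E =
   (wedge_moment a c h tau lam d)%:E)%E.
Proof.
move=> tau0.
pose A := \sum_i a i; pose C := \sum_i c i.
pose G := \sum_i a i * c i; pose S := \sum_i a i ^+ 2.
(* s, l and e are the shifted tau, lam and d as polynomials in t. *)
pose s : {poly R} := (tau + u)%:P - 'X.
pose l : {poly R} := lam%:P + a ord0 *: ('X - u%:P).
pose e : {poly R} := d%:P + c ord0 *: ('X - u%:P).
pose k1 : R := p.+2%:R^-1; pose k2 : R := (p.+2%:R * p.+3%:R)^-1.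
have sE t : s.[t] = tau - (t - u) by rewrite !hornerE; ring.
have lE t : l.[t] = lam + a ord0 * (t - u) by rewrite !hornerE.
have eE t : e.[t] = d + c ord0 * (t - u) by rewrite !hornerE.
have s' : s^`() = - 1%:P by rewrite derivB derivC derivX sub0r.
have l' : l^`() = (a ord0)%:P.
  by rewrite derivD derivC derivZ derivB derivX derivC subr0 add0r alg_polyC.
have e' : e^`() = (c ord0)%:P.
  by rewrite derivD derivC derivZ derivB derivX derivC subr0 add0r alg_polyC.
clearbody s l e.
pose Q : {poly R} :=
  e * l + k1 *: ((A *: e + C *: l) * s) + (k2 * (A * C + G)) *: s ^+ 2
  + (h / 2) *: (l ^+ 2 + (k1 * 2 * A) *: (l * s)
                + (k2 * (A ^+ 2 + S)) *: s ^+ 2).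
pose P : {poly R} := (- p.+1`!%:R^-1) *: (s ^+ p.+1 * Q).
pose hE := (hornerD, hornerN, hornerC, horner_exp, hornerZ, hornerM, hornerMn).
have PE t : P.[t] =
    - wedge_moment a c h (tau - (t - u)) (lam + a ord0 * (t - u))
        (d + c ord0 * (t - u)).
  rewrite /P /Q /wedge_moment -/A -/C -/G -/S !hE sE lE eE /k1 /k2.
  by rewrite invfM; ring.
have P'E t : P^`().[t] =
    wedge_moment (a \o lift ord0) (c \o lift ord0) h (tau - (t - u))
        (lam + a ord0 * (t - u)) (d + c ord0 * (t - u)).
  rewrite /P /Q !(derivD, derivN, derivZ, derivM, deriv_exp) s' l' e'.
  rewrite !hE sE lE eE.
  rewrite /wedge_moment /A /C /G /S !big_ord_recl /comp /k1 /k2.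
  rewrite factS /= (exprS _ p) natrM.
  set A' := \sum_(i < p) a _; set C' := \sum_(i < p) c _.
  set G' := \sum_(i < p) (a _ * c _); set S' := \sum_(i < p) _ ^+ 2.
  set a0 := a ord0; set c0 := c ord0.
  have f0 : p`!%:R != 0 :> R by rewrite pnatr_eq0 -lt0n fact_gt0.
  have q1 : 1 + p%:R != 0 :> R by rewrite nat1r pnatr_eq0.
  have q2 : 2 + p%:R != 0 :> R by rewrite -natrD pnatr_eq0.
  have q3 : 3 + p%:R != 0 :> R by rewrite -natrD pnatr_eq0.
  rewrite -[p.+3]add3n -[p.+2]add2n -[p.+1]add1n !natrD.
  by field; rewrite ?f0 ?q1 ?q2 ?q3.
under eq_integral do rewrite -P'E.
rewrite integral_deriv_poly ?lerDl// !PE; congr (_%:E).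
have -> : tau - (u + tau - u) = 0 by ring.
rewrite {1}/wedge_moment expr0n/= !mul0r oppr0 sub0r opprK.
by rewrite subrr !mulr0 !addr0 subr0.
Qed.

(** * Integration over the translated polytope *)

Section wedge.
Context {R : realType}.
Let T := measurableTypeR R.

Definition base_coord (p : nat) (x : p.+1.-tuple T) (i : 'I_p) : R :=
  tnth x (widen_ord (leqnSn p) i).

Definition top_coord (p : nat) (x : p.+1.-tuple T) : R := tnth x ord_max.

(** The bundle polytope with its lower corner at (l, z), and tau, lam and the
slopes a as free parameters: this family is closed under slicing by the first
coordinate. *)
Definition wedge (p : nat) (l a : 'I_p -> R) (z tau lam : R) :
    set (p.+1.-tuple T) :=
  [set x | [/\ forall i, l i <= base_coord x i,
    \sum_i (base_coord x i - l i) <= tau, z <= top_coord x &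
    top_coord x - z <= lam + \sum_i a i * (base_coord x i - l i)]].

(** An affine function expressed in coordinates relative to the lower corner, in
which it is nonnegative on the polytope as soon as its coefficients are. *)
Definition wedge_weight (p : nat) (l c : 'I_p -> R) (z h d : R)
    (x : p.+1.-tuple T) : R :=
  d + \sum_i c i * (base_coord x i - l i) + h * (top_coord x - z).

Lemma base_coord_cons0 p (t : R) (x : p.+1.-tuple T) :
  base_coord (cons_pair (t, x)) ord0 = t.
Proof. by rewrite /base_coord /= (_ : widen_ord _ _ = ord0)//; exact: val_inj. Qed.

Lemma base_coord_consS p (t : R) (x : p.+1.-tuple T) (i : 'I_p) :
  base_coord (cons_pair (t, x)) (lift ord0 i) = base_coord x i.
Proof.
rewrite /base_coord (_ : widen_ord _ _ = lift ord0 (widen_ord (leqnSn p) i)).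
  by rewrite tnthS.
exact: val_inj.
Qed.

Lemma top_coord_cons p (t : R) (x : p.+1.-tuple T) :
  top_coord (cons_pair (t, x)) = top_coord x.
Proof.
rewrite /top_coord (_ : ord_max = lift ord0 ord_max); first by rewrite tnthS.
exact: val_inj.
Qed.

Lemma measurable_base_coord p (i : 'I_p) :
  measurable_fun setT (fun x : p.+1.-tuple T => base_coord x i).
Proof. exact: measurable_tnth. Qed.

Lemma measurable_top_coord p :
  measurable_fun setT (@top_coord p).
Proof. exact: measurable_tnth. Qed.

Let measurable_comb p (l c : 'I_p -> R) :
  measurable_fun setT
    (fun x : p.+1.-tuple T => \sum_i c i * (base_coord x i - l i)).
Proof.
apply: measurable_sum => i; apply: measurable_funM => //.
by apply: measurable_funB => //; exact: measurable_base_coord.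
Qed.

Lemma measurable_wedge_weight p (l c : 'I_p -> R) (z h d : R) :
  measurable_fun setT (wedge_weight l c z h d).
Proof.
apply: measurable_funD.
  by apply: measurable_funD => //; exact: measurable_comb.
apply: measurable_funM => //.
by apply: measurable_funB => //; exact: measurable_top_coord.
Qed.

Lemma measurable_wedge p (l a : 'I_p -> R) (z tau lam : R) :
  measurable (wedge l a z tau lam).
Proof.
have mle (f g : p.+1.-tuple T -> R) : measurable_fun setT f ->
    measurable_fun setT g -> measurable [set x | f x <= g x].
  move=> mf mg; rewrite -[X in measurable X]setTI.
  exact: measurable_fun_le.
rewrite (_ : wedge _ _ _ _ _ =
  (\bigcap_i [set x | l i <= base_coord x i]) `&`
  [set x | \sum_i 1 * (base_coord x i - l i) <= tau] `&`
  [set x | z <= top_coord x] `&`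
  [set x | top_coord x - z <= lam + \sum_i a i * (base_coord x i - l i)]).
  apply: measurableI; [apply: measurableI; [apply: measurableI|]|].
  - apply: fin_bigcap_measurable => // i _.
    by apply: mle => //; exact: measurable_base_coord.
  - by apply: mle => //; exact: (measurable_comb l (fun=> 1)).
  - by apply: mle => //; exact: measurable_top_coord.
  - apply: mle; first by apply: measurable_funB => //; exact: measurable_top_coord.
    by apply: measurable_funD => //; exact: measurable_comb.
apply/seteqP; split=> x /=.
  move=> [xl xt zx xh]; split; last by [].
  split; last by [].
  split; first by move=> i _; exact: xl.
  by under eq_bigr do rewrite mul1r.
move=> [[[xl xt] zx] xh]; split=> //; first by move=> i; exact: xl.
by under eq_bigr do rewrite -[_ - _]mul1r.
Qed.

Lemma wedge_weight_ge0 p (l a c : 'I_p -> R) (z tau lam h d : R) x :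
  (forall i, 0 <= c i) -> 0 <= h -> 0 <= d ->
  wedge l a z tau lam x -> 0 <= wedge_weight l c z h d x.
Proof.
move=> c0 h0 d0 [xl _ zx _]; rewrite !addr_ge0 ?mulr_ge0 ?subr_ge0//.
by apply: sumr_ge0 => i _; rewrite mulr_ge0// subr_ge0.
Qed.

Lemma wedge_section p (l a : 'I_p.+1 -> R) (z tau lam t : R) :
  [set x | wedge l a z tau lam (cons_pair (t, x))] =
  if l ord0 <= t then
    wedge (l \o lift ord0) (a \o lift ord0) z (tau - (t - l ord0))
      (lam + a ord0 * (t - l ord0))
  else set0.
Proof.
case: ifPn => lt; apply/seteqP; split=> x //=; last first.
  by move=> [/(_ ord0)]; rewrite base_coord_cons0 (negbTE lt).
- move=> [xl xt zx xh]; split.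
  + move=> i; case: (unliftP ord0 i) => [j|] ->; last by rewrite base_coord_cons0.
    by rewrite base_coord_consS; exact: xl.
  + rewrite big_ord_recl base_coord_cons0 -lerBrDl.
    by under eq_bigr do rewrite base_coord_consS.
  + by rewrite top_coord_cons.
  + rewrite big_ord_recl base_coord_cons0 top_coord_cons addrA.
    by under eq_bigr do rewrite base_coord_consS.
- move=> [xl xt zx xh]; split.
  + by move=> i; have := xl (lift ord0 i); rewrite base_coord_consS.
  + move: xt; rewrite big_ord_recl base_coord_cons0 -lerBrDl.
    by under eq_bigr do rewrite base_coord_consS.
  + by move: zx; rewrite top_coord_cons.
  + move: xh; rewrite big_ord_recl base_coord_cons0 top_coord_cons addrA.
    by under eq_bigr do rewrite base_coord_consS.
Qed.

Lemma wedge_weight_cons p (l c : 'I_p.+1 -> R) (z h d t : R) x :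
  wedge_weight l c z h d (cons_pair (t, x)) =
  wedge_weight (l \o lift ord0) (c \o lift ord0) z h (d + c ord0 * (t - l ord0)) x.
Proof.
rewrite /wedge_weight big_ord_recl base_coord_cons0 top_coord_cons !addrA.
by under eq_bigr do rewrite base_coord_consS.
Qed.

Lemma wedge_tau_lt0 p (l a : 'I_p -> R) (z tau lam : R) :
  tau < 0 -> wedge l a z tau lam = set0.
Proof.
move=> tau0; apply/seteqP; split=> // x [xl xt _ _].
have : 0 <= \sum_i (base_coord x i - l i).
  by apply: sumr_ge0 => i _; rewrite subr_ge0.
by move=> /le_trans /(_ xt); rewrite leNgt tau0.
Qed.

Let affine_ge0 (x y w t : R) :
  0 <= w -> w <= t -> 0 <= x -> 0 <= x + y * t -> 0 <= x + y * w.
Proof.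
move=> w0 wt x0 xyt; have [y0|/ltW y0] := leP 0 y.
  by rewrite addr_ge0// mulr_ge0.
by rewrite (le_trans xyt)// lerD2l ler_wnM2l.
Qed.

(** The induction starts at dimension one, where the simplex is a point and the
integral is that of d + h (t - z) over an interval of length lam. *)
Lemma integral_wedge0 (l a c : 'I_0 -> R) (z tau lam h d : R) :
  0 <= h -> 0 <= d -> 0 <= tau -> 0 <= lam ->
  (\int[lebesgue_tuple 1]_(x in wedge l a z tau lam)
     (wedge_weight l c z h d x)%:E = (wedge_moment a c h tau lam d)%:E)%E.
Proof.
move=> h0 d0 tau0 lam0.
rewrite lebesgue_tuple_tonelli; last 3 first.
- exact: measurable_wedge.
- exact: measurable_wedge_weight.
- by move=> x; apply: wedge_weight_ge0 => // -[].
pose P : {poly R} := d *: ('X - z%:P) + (h / 2) *: ('X - z%:P) ^+ 2.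
rewrite (_ : (wedge_moment _ _ _ _ _ _)%:E =
   \int[lebesgue_measure]_(t in `[z, (z + lam)%R]) (P^`().[t])%:E)%E; last first.
  rewrite integral_deriv_poly ?lerDl// /wedge_moment !big_ord0.
  rewrite !(hornerD, hornerN, hornerC, horner_exp, hornerZ, hornerX).
  by congr (_%:E); rewrite fact0 expr0; field.
rewrite [RHS]integral_mkcond; apply: eq_integral => t _.
have -> : [set x | wedge l a z tau lam (cons_pair (t, x))] =
    if t \in `[z, z + lam] then setT else set0.
  rewrite in_itv/= addrC -lerBlDr; apply/seteqP; split=> x /=.
    by move=> [_ _ zt]; rewrite big_ord0 addr0 => tz; rewrite ifT// zt.
  case: ifPn => // /andP[zt tz] _; split=> //; first by case.
  - by rewrite big_ord0.
  - by rewrite big_ord0 addr0.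
rewrite patchE mem_setE; case: ifPn => _; last by rewrite integral_set0.
rewrite (eq_integral (cst (wedge_weight l c z h d (cons_pair (t, [tuple])))%:E)).
  rewrite integral_cst// [X in (_ * X)%E](_ : _ = 1%E) ?mule1; last first.
    exact: diracT.
rewrite /wedge_weight big_ord0 addr0.
rewrite /P !(derivD, derivN, derivZ, derivM, derivX, derivC, deriv_exp).
rewrite !(hornerD, hornerN, hornerC, hornerM, hornerMn, hornerZ, hornerX).
have -> : top_coord (cons_pair (t, [tuple])) = t by [].
  by congr (_%:E); field.
by move=> x _; rewrite (tuple0 x).
Qed.

(** Induction on p by slicing. The height function is affine, so the sign
conditions at the vertices of the simplex, lam and lam + a_i tau, pass to every
slice. Only nonnegative coefficients are allowed, which makes Tonelli's theorem
applicable before integrability is known. *)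
Lemma integral_wedge p (l a c : 'I_p -> R) (z tau lam h d : R) :
  (forall i, 0 <= c i) -> 0 <= h -> 0 <= d -> 0 <= tau -> 0 <= lam ->
  (forall i, 0 <= lam + a i * tau) ->
  (\int[lebesgue_tuple p.+1]_(x in wedge l a z tau lam)
     (wedge_weight l c z h d x)%:E = (wedge_moment a c h tau lam d)%:E)%E.
Proof.
move=> + h0; elim: p => [|p IHp] in l a c tau lam d *.
  by move=> _ d0 tau0 lam0 _; exact: integral_wedge0.
move=> c0 d0 tau0 lam0 alam0.
rewrite lebesgue_tuple_tonelli; last 3 first.
- exact: measurable_wedge.
- exact: measurable_wedge_weight.
- by move=> x; exact: wedge_weight_ge0.
rewrite -(@integral_wedge_moment _ _ _ _ _ _ _ _ (l ord0))//.
rewrite [RHS]integral_mkcond; apply: eq_integral => t _.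
rewrite patchE mem_setE in_itv/= wedge_section.
case: ifPn => [lt|_]; last by rewrite integral_set0.
case: ifPn => [tl|]; last first.
  rewrite -ltNge => tl; rewrite wedge_tau_lt0 ?integral_set0//.
  by rewrite subr_lt0 ltrBrDl.
rewrite -(IHp (l \o lift ord0))//.
- by apply: eq_integral => x _; rewrite wedge_weight_cons.
- by move=> i; exact: c0.
- by rewrite addr_ge0// mulr_ge0// subr_ge0.
- by rewrite subr_ge0 lerBlDl.
- by apply: (affine_ge0 (t := tau)); rewrite ?subr_ge0 ?lerBlDl.
- move=> i /=.
  have -> : lam + a ord0 * (t - l ord0) + a (lift ord0 i) * (tau - (t - l ord0))
      = (lam + a (lift ord0 i) * tau) + (a ord0 - a (lift ord0 i)) * (t - l ord0).
    by ring.
  apply: (affine_ge0 (t := tau)); rewrite ?subr_ge0 ?lerBlDl//.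
  by have := alam0 ord0; congr (0 <= _); ring.
Qed.
End wedge.

(** * The mass center *)

Section wedge_center.
Context {R : realType} (p : nat) (l a : 'I_p -> R) (z tau lam : R).
Hypotheses (tau_gt0 : 0 < tau) (lam_gt0 : 0 < lam)
  (alam_gt0 : forall i, 0 < lam + a i * tau).
Let T := measurableTypeR R.
Let W := wedge l a z tau lam.
Let mu := @lebesgue_tuple R p.+1.
Let vol := wedge_moment a (fun=> 0) 0 tau lam 1.

Let integral_weight (c : 'I_p -> R) (h d : R) :
  (forall i, 0 <= c i) -> 0 <= h -> 0 <= d ->
  (\int[mu]_(x in W) (wedge_weight l c z h d x)%:E =
   (wedge_moment a c h tau lam d)%:E)%E.
Proof.
by move=> c0 h0 d0; apply: integral_wedge => //; [exact: ltW..|move=> i; exact: ltW].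
Qed.

Let integrable_weight (c : 'I_p -> R) (h d : R) :
  (forall i, 0 <= c i) -> 0 <= h -> 0 <= d ->
  mu.-integrable W (EFin \o wedge_weight l c z h d).
Proof.
move=> c0 h0 d0; apply/integrableP; split.
  by apply/measurable_EFinP/measurable_funTS; exact: measurable_wedge_weight.
rewrite (eq_integral (EFin \o wedge_weight l c z h d)).
  by rewrite integral_weight// ltry.
move=> x /set_mem xW; rewrite gee0_abs// lee_fin.
exact: wedge_weight_ge0 xW.
Qed.

(** A coordinate may change sign, but it is the corresponding coordinate relative
to the lower corner plus a constant. *)
Let Rintegral_coord (f : p.+1.-tuple T -> R) (c : 'I_p -> R) (h r : R) :
  (forall i, 0 <= c i) -> 0 <= h ->
  (forall x, f x = wedge_weight l c z h 0 x + r) ->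
  Rintegral mu W f = wedge_moment a c h tau lam 0 + r * vol.
Proof.
move=> c0 h0 fE.
have fE' x : f x = wedge_weight l c z h 0 x
    + r * wedge_weight l (fun=> 0) z 0 1 x.
  rewrite fE {3}/wedge_weight mul0r addr0 big1 ?addr0 ?mulr1// => i _.
  by rewrite mul0r.
have mW : measurable W by exact: measurable_wedge.
rewrite (_ : f = fun x => wedge_weight l c z h 0 x
    + r * wedge_weight l (fun=> 0) z 0 1 x); last exact/funext.
rewrite RintegralD//; last 2 first.
- exact: integrable_weight.
- exact: (integrableZl mW r (@integrable_weight (fun=> 0) 0 1 _ _ _)).
rewrite RintegralZl//; last exact: integrable_weight.
by rewrite /Rintegral !integral_weight.
Qed.

Let volE : fine (mu W) = vol.
Proof.
rewrite -[mu W]mul1e -integral_cst; last exact: measurable_wedge.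
rewrite (eq_integral (EFin \o wedge_weight l (fun=> 0) z 0 1)).
  by rewrite integral_weight.
move=> x _; rewrite /= /wedge_weight mul0r addr0 big1 ?addr0// => i _.
by rewrite mul0r.
Qed.

Let A := \sum_i a i.

(** The mean of an affine function over a simplex is the mean of its values at the
p + 1 vertices, here lam and the lam + a_i tau. *)
Lemma mean_height_gt0 : 0 < lam + A * tau / p.+1%:R.
Proof.
rewrite -(pmulr_rgt0 _ (ltr0Sn R p)).
have -> : p.+1%:R * (lam + A * tau / p.+1%:R) =
    lam + \sum_i (lam + a i * tau).
  rewrite big_split/= sumr_const card_ord -mulr_suml -/A -nat1r.
  field; by rewrite nat1r pnatr_eq0.
by rewrite ltr_wpDr// sumr_ge0// => i _; exact: ltW.
Qed.

(** Division with remainder of the first moment by the volume, as polynomials in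
lam: the remainder is obtained by substituting lam = - A tau / (p+1), and its
coefficient is Z(b). *)
Lemma pairing_wedge_center (v : 'rV[R]_p.+1)
    (b := fun i => v 0 (widen_ord (leqnSn p) i)) (h := v 0 ord_max)
    (B := \sum_i b i) :
  pairing (mass_center W) v =
  \sum_i l i * b i + z * h + h / 2 * lam + (2 * B + h * A) / (2 * p.+1%:R) * tau
  + (p.+1%:R * (2 * (\sum_i a i * b i) + h * \sum_i a i ^+ 2)
     - A * (2 * B + h * A)) * tau ^+ 2
    / (2 * p.+1%:R ^+ 2 * p.+2%:R * (lam + A * tau / p.+1%:R)).
Proof.
pose K := tau ^+ p / p`!%:R; pose D := lam + A * tau / p.+1%:R.
have K_neq0 : K != 0.
  by rewrite mulf_neq0 ?invr_neq0 ?expf_neq0 ?gt_eqF ?ltr0n ?fact_gt0.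
have D_neq0 : D != 0 by rewrite gt_eqF// mean_height_gt0.
have q1 : 1 + p%:R != 0 :> R by rewrite nat1r pnatr_eq0.
have q2 : 2 + p%:R != 0 :> R by rewrite -natrD pnatr_eq0.
have D'_neq0 : lam * (1 + p%:R) + A * tau != 0.
  rewrite (_ : _ + _ = D * (1 + p%:R)) ?mulf_neq0// /D -nat1r.
  by field.
have sum_a0 : \sum_i a i * 0 = 0 by rewrite -mulr_suml mulr0.
have volD : vol = K * D.
  by rewrite /vol /wedge_moment -/A -/K /D sum_a0 big1_eq; ring.
have sum_delta (f : 'I_p -> R) j : \sum_i f i * (i == j)%:R = f j.
  rewrite (bigD1 j)//= eqxx mulr1 big1 ?addr0// => i /negbTE ->.
  by rewrite mulr0.
rewrite /pairing big_ord_recr/= tnth_mktuple volE.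
have -> : Rintegral mu W (fun x => tnth x ord_max : R) =
    wedge_moment a (fun=> 0) 1 tau lam 0 + z * vol.
  apply: Rintegral_coord => // x.
  rewrite /wedge_weight big1 ?add0r ?mul1r ?subrK// => i _.
  by rewrite mul0r.
have coordE j : Rintegral mu W (fun x => tnth x (widen_ord (leqnSn p) j) : R) =
    wedge_moment a (fun i => (i == j)%:R) 0 tau lam 0 + l j * vol.
  apply: Rintegral_coord => // x.
  rewrite /wedge_weight mul0r addr0 add0r (bigD1 j)//= eqxx mul1r big1 ?addr0 ?subrK//.
  by move=> i /negbTE ->; rewrite mul0r.
under eq_bigr do rewrite tnth_mktuple volE coordE.
rewrite (eq_bigr (fun j => l j * b j + K * lam * tau / p.+1%:R / vol * b j
    + K * tau ^+ 2 / (p.+1%:R * p.+2%:R) / vol * (A * b j + a j * b j))); last first.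
  move=> j _; rewrite {1}/wedge_moment -/A -/K sum_delta.
  have -> : \sum_i (i == j)%:R = 1 :> R.
    by rewrite -[RHS](sum_delta (fun=> 1) j); apply: eq_bigr => i _; rewrite mul1r.
  rewrite -/(b j) volD.
  by field; rewrite D_neq0 K_neq0 q1 q2.
rewrite !big_split/= -!mulr_sumr -/B big_split/= -mulr_sumr -/B.
rewrite /wedge_moment -/A -/K volD /D.
rewrite sum_a0 big1_eq.
rewrite -/h.
by field; rewrite q1 q2 K_neq0 D'_neq0.
Qed.

End wedge_center.

(** * The combinatorial chamber *)

Section bundle_polytope.
Context {R : realType} (p : nat) (a : 'rV[int]_p).
Let T := measurableTypeR R.
Implicit Types (k : 'rV[R]_p.+3) (x : p.+1.-tuple T) (J : set 'I_p.+3).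

Definition slope (i : 'I_p) : R := (a 0 i)%:~R.
(** The lower corner (low_side, low_top), the size tau of the simplex (base_size)
and the height lam above the lower corner (fiber_height) of the polytope with
support vector k. *)
Definition low_side k (i : 'I_p) : R := - k 0 (inord i).
Definition low_top k : R := - k 0 (inord p.+1).
Definition base_size k : R := k 0 (inord p) + \sum_(i < p) k 0 (inord i).
Definition fiber_height k : R :=
  k 0 (inord p.+2) + k 0 (inord p.+1) - \sum_(i < p) slope i * k 0 (inord i).

Lemma bundle_index_ind (P : 'I_p.+3 -> Prop) :
  (forall i : 'I_p, P (inord i)) -> P (inord p) -> P (inord p.+1) ->
  P (inord p.+2) -> forall j, P j.
Proof.
move=> Ps Pp Pp1 Pp2 j; rewrite -(inord_val j).
have := ltn_ord j; rewrite ltnS leq_eqVlt => /predU1P[->//|].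
rewrite ltnS leq_eqVlt => /predU1P[->//|].
rewrite ltnS leq_eqVlt => /predU1P[->//|jp].
exact: Ps (Ordinal jp).
Qed.

Let pairingN x v : pairing x (- v) = - pairing x v :> R.
Proof. by rewrite /pairing -sumrN; apply: eq_bigr => i _; rewrite mxE mulrN. Qed.

Let pairingD x v w : pairing x (v + w) = pairing x v + pairing x w :> R.
Proof. by rewrite /pairing -big_split; apply: eq_bigr => i _; rewrite mxE mulrDr. Qed.

Let pairingZ x c v : pairing x (c *: v) = c * pairing x v :> R.
Proof. by rewrite /pairing mulr_sumr; apply: eq_bigr => i _; rewrite mxE mulrCA. Qed.

Let pairing_sum x (f : 'I_p -> 'rV[R]_p.+1) :
  pairing x (\sum_i f i) = \sum_i pairing x (f i).
Proof.
rewrite /pairing exchange_big; apply: eq_bigr => i _.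
by rewrite summxE mulr_sumr.
Qed.

Let pairing_bvec x (i : 'I_p.+1) : pairing x (bvec i) = tnth x i :> R.
Proof.
rewrite /pairing (bigD1 i)//= mxE eqxx mulr1 big1 ?addr0// => l li.
by rewrite mxE (negbTE li : (l == i :> nat) = false) mulr0.
Qed.

Let pairing_base x (i : 'I_p) : pairing x (bvec i) = base_coord x i.
Proof. by rewrite /base_coord -pairing_bvec. Qed.

Let pairing_top x : pairing x (bvec p) = top_coord x.
Proof. by rewrite /top_coord -pairing_bvec. Qed.

Lemma pairing_side x (i : 'I_p) :
  pairing x (bundle_conormal a (inord i)) = - base_coord x i.
Proof.
have ip := ltn_ord i.
rewrite /bundle_conormal inordK ?ip ?pairingN ?pairing_base//.
by rewrite (leq_trans ip)// -addn3 leq_addr.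
Qed.

Lemma pairing_slant x :
  pairing x (bundle_conormal a (inord p)) = \sum_i base_coord x i.
Proof.
rewrite /bundle_conormal inordK ?ltnS ?leqW// ltnn eqxx pairing_sum.
by apply: eq_bigr => i _; exact: pairing_base.
Qed.

Lemma pairing_bottom x :
  pairing x (bundle_conormal a (inord p.+1)) = - top_coord x.
Proof.
rewrite /bundle_conormal inordK ?ltnS// ltnNge leqnSn/= gtn_eqF// eqxx.
by rewrite pairingN pairing_top.
Qed.

Lemma pairing_roof x :
  pairing x (bundle_conormal a (inord p.+2)) =
  top_coord x - \sum_i slope i * base_coord x i.
Proof.
rewrite /bundle_conormal inordK// ltnNge (leq_trans (leqnSn p))//=.
rewrite gtn_eqF ?ltnS// gtn_eqF// pairingD pairingN pairing_top pairing_sum.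
by congr (_ - _); apply: eq_bigr => i _; rewrite pairingZ pairing_base.
Qed.

Notation wedge_of k :=
  (wedge (low_side k) slope (low_top k) (base_size k) (fiber_height k)).

Let sum_low k x : \sum_i (base_coord x i - low_side k i) =
  \sum_i base_coord x i + \sum_(i < p) k 0 (inord i).
Proof. by rewrite -big_split; apply: eq_bigr => i _; rewrite /low_side opprK. Qed.

Let sum_slope_low k x : \sum_i slope i * (base_coord x i - low_side k i) =
  \sum_i slope i * base_coord x i + \sum_(i < p) slope i * k 0 (inord i).
Proof.
by rewrite -big_split; apply: eq_bigr => i _; rewrite /low_side opprK mulrDr.
Qed.

Lemma bundle_polytope_wedge k : polytope (bundle_conormal a) k = wedge_of k.
Proof.
apply/seteqP; split=> x /=.
  move=> Px; split.
  - by move=> i; have := Px (inord i); rewrite pairing_side lerNl.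
  - by have := Px (inord p); rewrite pairing_slant sum_low lerD2r.
  - by have := Px (inord p.+1); rewrite pairing_bottom lerNl.
  - have := Px (inord p.+2); rewrite pairing_roof sum_slope_low /low_top /fiber_height.
    by lra.
move=> [xl xt zx xh]; apply: bundle_index_ind.
- by move=> i; rewrite pairing_side lerNl; exact: xl.
- by move: xt; rewrite pairing_slant sum_low lerD2r.
- by rewrite pairing_bottom lerNl.
- by move: xh; rewrite pairing_roof sum_slope_low /low_top /fiber_height; lra.
Qed.

Let facet_side k x (i : 'I_p) : wedge_of k x ->
  facet (bundle_conormal a) k (inord i) x <-> base_coord x i = low_side k i.
Proof.
rewrite -bundle_polytope_wedge /facet /= pairing_side /low_side => Wx.
by split=> [[_ <-]|->]; rewrite opprK.
Qed.

Let facet_slant k x : wedge_of k x ->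
  facet (bundle_conormal a) k (inord p) x <->
  \sum_i (base_coord x i - low_side k i) = base_size k.
Proof.
rewrite -bundle_polytope_wedge /facet /= pairing_slant sum_low => Wx.
by split=> [[_ ->]//|/addIr].
Qed.

Let facet_bottom k x : wedge_of k x ->
  facet (bundle_conormal a) k (inord p.+1) x <-> top_coord x = low_top k.
Proof.
rewrite -bundle_polytope_wedge /facet /= pairing_bottom /low_top => Wx.
by split=> [[_ <-]|->]; rewrite opprK.
Qed.

Let facet_roof k x : wedge_of k x ->
  facet (bundle_conormal a) k (inord p.+2) x <->
  top_coord x - low_top k =
    fiber_height k + \sum_i slope i * (base_coord x i - low_side k i).
Proof.
rewrite -bundle_polytope_wedge /facet /= pairing_roof sum_slope_low => Wx.
by rewrite /low_top /fiber_height; split=> [[_ ?]|?]; [|split=> //]; lra.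
Qed.

Definition nondegenerate k : Prop :=
  [/\ 0 < base_size k, 0 < fiber_height k &
      forall i, 0 < fiber_height k + slope i * base_size k].

(** The families of facets of a product of a simplex and a segment that have a
common point: they omit one of the p + 1 facets of the simplex, and one end of
the segment. *)
Definition bundle_face_type J : Prop :=
  (exists2 i, (i <= p)%N & ~ J (inord i)) /\
  ~ (J (inord p.+1) /\ J (inord p.+2)).

(** tau times the height at y is lam (tau - sum_i y_i) + sum_i y_i (lam + a_i tau),
a combination of the positive heights at the vertices. *)
Let height_gt0 (tau lam : R) (y : 'I_p -> R) :
  0 < tau -> 0 < lam -> (forall i, 0 < lam + slope i * tau) ->
  (forall i, 0 <= y i) -> \sum_i y i <= tau ->
  0 < lam + \sum_i slope i * y i.
Proof.
move=> tau0 lam0 alam0 y0 ytau; rewrite -(pmulr_rgt0 _ tau0).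
have -> : tau * (lam + \sum_i slope i * y i) =
    lam * (tau - \sum_i y i) + \sum_i y i * (lam + slope i * tau).
  have -> : \sum_i y i * (lam + slope i * tau) =
      lam * (\sum_i y i) + tau * \sum_i slope i * y i.
    by rewrite !mulr_sumr -big_split; apply: eq_bigr => i _ /=; ring.
  by ring.
have yl0 i : 0 <= y i * (lam + slope i * tau) by rewrite mulr_ge0// ltW.
have [[i yi]|/forallNP yN0] := pselect (exists i, y i != 0).
  rewrite ltr_wpDl ?mulr_ge0 ?subr_ge0 ?(ltW lam0)// (bigD1 i)//= ltr_pwDl//.
    by rewrite mulr_gt0// lt_def yi y0.
  by apply: sumr_ge0 => j _.
have {}yN0 i : y i = 0 by apply/eqP/negPn/negP; exact: yN0.
rewrite ltr_pwDl//; last by apply: sumr_ge0.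
by rewrite big1 ?subr0 ?mulr_gt0.
Qed.

(** Meeting all facets of the simplex would force tau = 0, and meeting bottom and
roof would force a vanishing height. Otherwise the vertex of the simplex opposite
to an omitted facet, lifted to the bottom or to the roof, is a common point. *)
Lemma nondegenerate_faceE k J : nondegenerate k ->
  \bigcap_(j in J) facet (bundle_conormal a) k j !=set0 <-> bundle_face_type J.
Proof.
move=> [tau0 lam0 alam0]; split=> [[x Jx]|[[i0 i0p Ji0] JN]].
  have W j : J j -> wedge_of k x.
    by move=> /Jx[]; rewrite bundle_polytope_wedge.
  split.
    apply: contrapT => /forall2NP Jle.
    have {}Jle i : (i <= p)%N -> J (inord i).
      by move=> ip; have [//|/contrapT] := Jle i.
    have Wx : wedge_of k x by exact: W (Jle p (leqnn p)).
    have := (facet_slant Wx).1 (Jx _ (Jle p (leqnn p))).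
    rewrite big1 => [tauE|i _]; first by move: tau0; rewrite -tauE ltxx.
    rewrite ((facet_side i Wx).1 (Jx _ (Jle i (ltnW (ltn_ord i))))).
    exact: subrr.
  move=> [J1 J2]; have Wx := W _ J1.
  have := (facet_roof Wx).1 (Jx _ J2).
  rewrite ((facet_bottom Wx).1 (Jx _ J1)) subrr => /esym hE.
  have [xl xt _ _] := Wx.
  have := height_gt0 tau0 lam0 alam0 (y := fun i => base_coord x i - low_side k i).
  by rewrite hE ltxx => H; suff: false by []; apply: H => // i; rewrite subr_ge0.
(* For i0 = p, the slanted facet, no coordinate matches and y is the origin. *)
pose y (i : 'I_p) := if i == i0 :> nat then base_size k else 0.
have y0 i : 0 <= y i by rewrite /y; case: ifP => // _; exact: ltW.
have ysum : \sum_i y i = if (i0 < p)%N then base_size k else 0.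
  case: ifPn => [ip|].
    rewrite (bigD1 (Ordinal ip))//= /y eqxx big1 ?addr0// => i ii0.
    by rewrite ifN//; apply: contra ii0 => /eqP ii0; apply/eqP/val_inj.
  rewrite -leqNgt => pi0; rewrite big1// => i _; rewrite /y ifN//.
  by rewrite ltn_eqF// (leq_trans _ pi0).
have ytau : \sum_i y i <= base_size k by rewrite ysum; case: ifP => // _; exact: ltW.
pose hy := fiber_height k + \sum_i slope i * y i.
have hy0 : 0 < hy by exact: (height_gt0 tau0 lam0 alam0 y0 ytau).
pose t := if pselect (J (inord p.+1)) then 0 else hy.
pose x : p.+1.-tuple T :=
  [tuple if unlift ord_max j is Some i then low_side k i + y i
         else low_top k + t | j < p.+1].
have xb i : base_coord x i = low_side k i + y i.
  rewrite /base_coord tnth_mktuple.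
  rewrite (_ : widen_ord _ _ = lift ord_max i) ?liftK//.
  by apply: val_inj; rewrite [RHS]lift_max.
have xt : top_coord x = low_top k + t.
  by rewrite /top_coord tnth_mktuple unlift_none.
have xy i : base_coord x i - low_side k i = y i by rewrite xb addrAC subrr add0r.
have xs : \sum_i (base_coord x i - low_side k i) = \sum_i y i.
  by apply: eq_bigr => i _; exact: xy.
have xh : \sum_i slope i * (base_coord x i - low_side k i) = \sum_i slope i * y i.
  by apply: eq_bigr => i _; rewrite xy.
have Wx : wedge_of k x.
  split.
  - by move=> i; rewrite -subr_ge0 xy; exact: y0.
  - by rewrite xs.
  - rewrite xt lerDl /t; by case: pselect => /= _ //; exact: ltW.
  - rewrite xh xt -/hy addrAC subrr add0r /t; by case: pselect => /= _ //; exact: ltW.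
exists x; apply: bundle_index_ind.
- move=> i Ji; apply/(facet_side i Wx); rewrite xb /y ifN ?addr0//.
  by apply: (contra_notN _ Ji0) => /eqP <-.
- move=> Jp; apply/(facet_slant Wx); rewrite xs ysum ifT// ltn_neqAle i0p andbT.
  by apply: (contra_notN _ Ji0) => /eqP ->.
- move=> J1; apply/(facet_bottom Wx); rewrite xt /t; case: pselect => //= _.
  by rewrite addr0.
- move=> J2; apply/(facet_roof Wx); rewrite xh xt -/hy addrAC subrr add0r /t.
  by case: pselect => //= J1; exfalso; exact: JN.
Qed.

(** Each vertex of the bottom is a common point of p facets of the simplex and
the bottom facet. It lies in the polytope, which gives the weak inequalities for
tau and for the height at that vertex; equality would put it on a facet too many. *)
Lemma face_types_nondegenerate k :
  (forall J, \bigcap_(j in J) facet (bundle_conormal a) k j !=set0 <->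
     bundle_face_type J) -> nondegenerate k.
Proof.
move=> faces.
have empty J x : (forall j, J j -> facet (bundle_conormal a) k j x) ->
    bundle_face_type J.
  by move=> Jx; apply/faces; exists x.
have inordK3 i : (i <= p.+2)%N -> (inord i : 'I_p.+3) = i :> nat.
  by move=> ip; rewrite inordK.
have inord_neq i j : (i <= p.+2)%N -> (j <= p.+2)%N -> i != j ->
    inord i <> inord j :> 'I_p.+3.
  move=> ip jp /eqP ij /(congr1 (@nat_of_ord _)).
  by rewrite !inordK3.
have vertex i0 : (i0 <= p)%N -> exists x, [/\ wedge_of k x,
    forall i, (i <= p)%N -> i != i0 -> facet (bundle_conormal a) k (inord i) x,
    facet (bundle_conormal a) k (inord p.+1) x,
    ~ facet (bundle_conormal a) k (inord i0) x &
    ~ facet (bundle_conormal a) k (inord p.+2) x].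
  move=> i0p; have i0p2 : (i0 <= p.+2)%N by rewrite !leqW.
  have [|x Jx] := (faces [set j | j <> inord i0 /\ j <> inord p.+2]).2.
    split; first by exists i0 => // -[].
    by case=> _ [].
  have fx i : (i <= p)%N -> i != i0 -> facet (bundle_conormal a) k (inord i) x.
    move=> ip ii0; apply: Jx; split; apply: inord_neq => //; rewrite ?leqW//.
    by rewrite ltn_eqF// ltnS leqW.
  have fx1 : facet (bundle_conormal a) k (inord p.+1) x.
    apply: Jx; split; apply: inord_neq => //; last by rewrite ltn_eqF.
    by rewrite gtn_eqF.
  have Wx : wedge_of k x by rewrite -bundle_polytope_wedge; exact: fx1.1.
  exists x; split => // fi0.
  - have [|[i ip]] := empty [set j : 'I_p.+3 | (j <= p)%N] x.
      move=> j /= jp; rewrite -(inord_val j).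
      by have [->//|ji0] := eqVneq (j : nat) i0; exact: fx.
    by rewrite /= inordK3 ?leqW.
  - have [|_ []] := empty [set j : 'I_p.+3 | (p < j)%N] x.
      move=> j /= pj; rewrite -(inord_val j).
      have := ltn_ord j; rewrite ltnS leq_eqVlt => /predU1P[->//|].
      rewrite ltnS => jp1; have -> : j = p.+1 :> nat.
        by apply/eqP; rewrite eqn_leq jp1.
      by [].
    by rewrite /= !inordK3.
have [x [Wx xs xb Np Nr]] := vertex p (leqnn p).
have xl i : base_coord x i - low_side k i = 0.
  apply/eqP; rewrite subr_eq0; apply/eqP/(facet_side i Wx)/xs.
    exact/ltnW/ltn_ord.
  by rewrite ltn_eqF.
have tau_gt0 : 0 < base_size k.
  have [_ xt _ _] := Wx; rewrite lt_def; move: xt.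
  rewrite big1// => -> ; rewrite andbT; apply/eqP => tauE.
  by apply: Np; apply/(facet_slant Wx); rewrite big1.
split=> //.
  have [_ _ _] := Wx; rewrite ((facet_bottom Wx).1 xb) subrr big1 ?addr0; last first.
    by move=> i _; rewrite xl mulr0.
  rewrite lt_def => ->; rewrite andbT; apply/eqP => lamE.
  apply: Nr; apply/(facet_roof Wx); rewrite lamE.
  rewrite ((facet_bottom Wx).1 xb) subrr big1 ?addr0//.
  by move=> i _; rewrite xl mulr0.
move=> i; have ip := ltn_ord i.
have [y [Wy ys yb _ Nry]] := vertex i (ltnW ip).
have yl j : j != i -> base_coord y j - low_side k j = 0.
  move=> ji; apply/eqP; rewrite subr_eq0; apply/eqP/(facet_side j Wy)/ys => //.
  exact/ltnW/ltn_ord.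
have yi : base_coord y i - low_side k i = base_size k.
  rewrite -((facet_slant Wy).1 (ys p _ _)) ?gtn_eqF//.
  by rewrite (bigD1 i)//= big1 ?addr0.
have ysl : \sum_j slope j * (base_coord y j - low_side k j) = slope i * base_size k.
  by rewrite (bigD1 i)//= yi big1 ?addr0// => j /yl ->; rewrite mulr0.
have [_ _ _] := Wy; rewrite ((facet_bottom Wy).1 yb) subrr ysl.
rewrite lt_def => ->; rewrite andbT; apply/eqP => hE.
by apply: Nry; apply/(facet_roof Wy); rewrite ysl hE ((facet_bottom Wy).1 yb) subrr.
Qed.

End bundle_polytope.

(** * Mass linearity *)

Section mass_linearity.
Context {R : realType} (p : nat) (a : 'rV[int]_p).
Implicit Types (k : 'rV[R]_p.+3) (v : 'rV[R]_p.+1).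

Lemma bundle_chamberE k k' : nondegenerate a k ->
  chamber (bundle_conormal a) k k' <-> nondegenerate a k'.
Proof.
move=> ndk; split=> [kk'|ndk' J].
  apply: face_types_nondegenerate => J.
  by rewrite -(nondegenerate_faceE J ndk); split=> /kk'.
by rewrite (nondegenerate_faceE J ndk) (nondegenerate_faceE J ndk').
Qed.

(** The contribution of the lower corner plus the quotient in the division of the
first moment by the volume. *)
Definition center_form v k : R :=
  let b i := v 0 (widen_ord (leqnSn p) i) in
  let h := v 0 ord_max in
  \sum_i low_side k i * b i + low_top k * h + h / 2 * fiber_height a k
  + (2 * (\sum_i b i) + h * \sum_i slope a i) / (2 * p.+1%:R) * base_size k.

Definition mean_height k : R :=
  fiber_height a k + (\sum_i slope a i) * base_size k / p.+1%:R.

Lemma center_form_scalar v : scalar (center_form v).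
Proof.
move=> c k k'; rewrite /center_form.
have lE i : low_side (c *: k + k') i = c * low_side k i + low_side k' i.
  by rewrite /low_side !mxE; ring.
have tE : low_top (c *: k + k') = c * low_top k + low_top k'.
  by rewrite /low_top !mxE; ring.
have sE : base_size (c *: k + k') = c * base_size k + base_size k'.
  rewrite /base_size; under eq_bigr do rewrite !mxE.
  by rewrite big_split/= -mulr_sumr !mxE; ring.
have hE : fiber_height a (c *: k + k') = c * fiber_height a k + fiber_height a k'.
  rewrite /fiber_height; under eq_bigr do rewrite !mxE mulrDr mulrCA.
  by rewrite big_split/= -mulr_sumr !mxE; ring.
rewrite tE sE hE; under eq_bigr do rewrite lE mulrDl -mulrA.
by rewrite big_split/= -mulr_sumr; ring.
Qed.

Lemma pairing_bundle_center (b : 'rV[int]_p.+1) k : nondegenerate a k ->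
  pairing (mass_center (polytope (bundle_conormal a) k)) (map_mx intr b) =
  center_form (map_mx intr b) k + (bundle_Z a b)%:~R *
    (base_size k ^+ 2 / (2 * p.+1%:R ^+ 2 * p.+2%:R * mean_height k)).
Proof.
move=> [s0 h0 sh0]; rewrite bundle_polytope_wedge pairing_wedge_center//.
rewrite /center_form/=; congr (_ + _); rewrite [RHS]mulrA; congr (_ * _ / _).
have aE : (\sum_j a 0 j)%:~R = \sum_j slope a j :> R by rewrite rmorph_sum.
have bE : (\sum_(j < p) b 0 (widen_ord (leqnSn p) j))%:~R =
    \sum_(j < p) map_mx intr b 0 (widen_ord (leqnSn p) j) :> R.
  by rewrite rmorph_sum; apply: eq_bigr => j _; rewrite mxE.
have abE : (\sum_(j < p) a 0 j * b 0 (widen_ord (leqnSn p) j))%:~R =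
    \sum_(j < p) slope a j * map_mx intr b 0 (widen_ord (leqnSn p) j) :> R.
  by rewrite rmorph_sum; apply: eq_bigr => j _; rewrite mxE/= intrM.
have aaE : (\sum_j a 0 j ^+ 2)%:~R = \sum_j slope a j ^+ 2 :> R.
  by rewrite rmorph_sum; apply: eq_bigr => j _; rewrite /= rmorphXn.
rewrite /bundle_Z intrB !intrM !intrD !intrM aE bE abE aaE.
by rewrite [map_mx intr b 0 ord_max]mxE.
Qed.


Lemma scalar_midpoint (V : lmodType R) (L : V -> R) (u v w : V) :
  scalar L -> u + w = v + v -> L u + L w = 2 * L v.
Proof.
move=> linL uw; have := linL 1 u w; have := linL 1 v v.
by rewrite !scale1r uw !mul1r => -> /esym ->; rewrite mulr_natl mulr2n.
Qed.

Lemma inv_second_difference (x : R) : 0 < x ->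
  x^-1 + (x + 2)^-1 - 2 * (x + 1)^-1 = 2 / (x * (x + 1) * (x + 2)).
Proof.
by move=> x0; field; rewrite !gt_eqF ?addr_gt0.
Qed.

End mass_linearity.

Unset Implicit Arguments.

Theorem theorem11 (R : realType) (p : nat) (a : 'rV[int]_p) (tau lambda : R)
    (b : 'rV[int]_p.+1) (p_gt1 : (1 < p)%N) (tau_gt0 : 0 < tau)
    (lambda_gt0 : 0 < lambda)
    (a_gt0 : forall i : 'I_p, 0 < lambda + (a 0 i)%:~R * tau) :
  mass_linear (bundle_conormal a) (bundle_support tau lambda)
    (map_mx intr b) <-> bundle_Z a b = 0.
Proof.
pose k (s : R) : 'rV[R]_p.+3 := bundle_support tau (lambda + s).
have support0 s (i : 'I_p) : k s 0 (inord i) = 0.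
  have ip := ltn_ord i.
  have ip2 : (i < p.+2)%N by rewrite ltnW// ltnS ltnW.
  by rewrite mxE inordK ?ltn_eqF// ltnW.
have size_k s : base_size (k s) = tau.
  rewrite /base_size big1 => [|i _]; last exact: support0.
  by rewrite mxE inordK ?eqxx ?addr0// ltnS leqW.
have height_k s : fiber_height a (k s) = lambda + s.
  rewrite /fiber_height big1 => [|i _]; last by rewrite support0 mulr0.
  have e1 : (p.+2 == p) = false by rewrite gtn_eqF.
  have e2 : (p.+1 == p) = false by rewrite gtn_eqF.
  have e3 : (p.+1 == p.+2) = false by rewrite ltn_eqF.
  by rewrite !mxE !inordK// eqxx e1 e2 e3 addr0 subr0.
have nd_k s : 0 <= s -> nondegenerate a (k s).
  move=> s0; split=> [||i]; rewrite ?size_k ?height_k//.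
    exact: ltr_wpDr.
  by rewrite addrAC; apply: ltr_wpDr => //; exact: a_gt0.
have k0 : bundle_support tau lambda = k 0 by rewrite /k addr0.
split=> [[L linL centerL]|Z0]; last first.
  exists (center_form a (map_mx intr b)); first exact: center_form_scalar.
  move=> k'; rewrite k0 => /(bundle_chamberE _ (nd_k 0 _)) ndk'.
  by rewrite pairing_bundle_center ?Z0 ?mul0r ?addr0//; exact: ndk'.
pose D := mean_height a (k 0).
have D_gt0 : 0 < D.
  have [s0 h0 sh0] := nd_k 0 (lexx 0).
  exact: mean_height_gt0.
pose Q : R := tau ^+ 2 / (2 * p.+1%:R ^+ 2 * p.+2%:R).
have Q_gt0 : 0 < Q by rewrite divr_gt0 ?mulr_gt0 ?exprn_gt0.
have gap_gt0 : 0 < 2 / (D * (D + 1) * (D + 2)).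
  have D1_gt0 : 0 < D + 1 by exact: ltr_wpDr.
  have D2_gt0 : 0 < D + 2 by exact: ltr_wpDr.
  by rewrite divr_gt0 ?mulr_gt0.
have LE s : 0 <= s ->
    L (k s) = center_form a (map_mx intr b) (k s) + (bundle_Z a b)%:~R * Q / (D + s).
  move=> s0; rewrite -centerL; last by rewrite k0; apply/bundle_chamberE; exact: nd_k.
  rewrite pairing_bundle_center; last exact: nd_k.
  rewrite size_k (_ : mean_height a (k s) = D + s).
    by rewrite invfM !mulrA.
  by rewrite /D /mean_height !size_k !height_k; ring.
have mid : k 0 + k 2 = k 1 + k 1.
  apply/rowP => j; rewrite !mxE; case: eqP => _ //; case: eqP => _ //.
  ring.
have := scalar_midpoint linL mid.
rewrite !LE// => E1.
have E2 := scalar_midpoint (center_form_scalar a (map_mx intr b)) mid.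
have : (bundle_Z a b)%:~R * (Q * (2 / (D * (D + 1) * (D + 2)))) = 0.
  rewrite -inv_second_difference//.
  move: E1; rewrite addr0. lra.
move/eqP; rewrite mulf_eq0 intr_eq0 => /orP[/eqP//|].
by rewrite gt_eqF// mulr_gt0.
Qed.
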